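(* For every $k \geq 0$ there exists $d$ such that the $d$-dimensional cube-connected cycle $CCC^d$ is fan-crossing free and quasi-planar, but is neither $k$-planar, nor $k$-gap-planar, nor fan-crossing.
   Context: All graphs are simple. Drawings are in the plane, with vertices as distinct points and edges as Jordan arcs not passing through vertices; drawings are simple: adjacent edges do not cross and two edges cross at most once. A graph has a property if it admits a drawing with that property. A drawing is fan-crossing free if no edge is crossed by two edges sharing a common endpoint; fan-crossing if for every edge $e$ all edges crossing $e$ share a common endpoint; $k$-planar if every edge is crossed by at most $k$ edges; $k$-gap-planar if each crossing can be assigned to one of its two edges so that at most $k$ crossings are assigned to each edge; quasi-planar if no three edges pairwise cross. The $d$-dimensional hypercube $H^d$ has the $2^d$ binary strings of length $d$ as vertices, two being adjacent iff they differ in exactly one position. The $d$-dimensional cube-connected cycle $CCC^d$ is obtained from $H^d$ by replacing each vertex $x$ by a cycle of $d$ vertices $(x,1),\dots,(x,d)$ (edges $(x,i)(x,i+1)$ and $(x,d)(x,1)$) and joining $(x,i)$ to $(y,i)$ whenever $x$ and $y$ differ exactly in position $i$; it has $d2^d$ vertices, all of degree three. *)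

(* Defs.v *)
(* MathComp / MathComp-Analysis. *)
From HB Require Import structures.
From mathcomp Require Import all_boot all_order all_algebra.
From mathcomp Require Import all_classical all_reals all_analysis.

Set Implicit Arguments.
Unset Strict Implicit.
Unset Printing Implicit Defensive.

Import Order.TTheory GRing.Theory Num.Theory.
Import numFieldNormedType.Exports.

Local Open Scope classical_set_scope.
Local Open Scope ring_scope.

Record sgraph := SGraph {
  vertex :> finType;
  adj : rel vertex;
  adj_sym : symmetric adj;
  adj_irrefl : irreflexive adj
}.

Definition is_edge (G : sgraph) (e : {set G}) : bool :=
  [exists u : G, [exists v : G, adj u v && (e == [set u; v]%SET)]].

Definition edge (G : sgraph) := {e : {set G} | is_edge e}.

Definition incident (G : sgraph) (v : G) (e : edge G) : bool := v \in val e.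

Definition adjacent_edges (G : sgraph) (e f : edge G) : Prop :=
  e <> f /\ exists v : G, incident v e /\ incident v f.

(* The plane is R * R with its product topology.  The edge e is the image of
   [0, 1] under [edge_arc e]; the values of [edge_arc e] outside [0, 1] are irrelevant,
   and nothing depends on the direction in which an edge is parametrised. *)
Record drawing (R : realType) (G : sgraph) := Drawing {
  point_of : G -> R * R;
  edge_arc : edge G -> R -> R * R;
  point_of_inj : injective point_of;
  arc_continuous : forall e, {within `[0%R, 1%R], continuous (edge_arc e)};
  arc_inj : forall e, {in `[0%R, 1%R] &, injective (edge_arc e)};
  arc_ends : forall e, exists u v : G,
    [/\ val e = [set u; v]%SET, edge_arc e 0 = point_of u & edge_arc e 1 = point_of v];
  arc_avoids_vertices : forall e (t : R) (v : G),
    0 < t < 1 -> edge_arc e t <> point_of v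
}.

Definition interior_points (R : realType) (G : sgraph) (D : drawing R G)
    (e : edge G) : set (R * R) :=
  [set edge_arc D e t | t in `]0%R, 1%R[].

(* Every common interior point of two distinct edges is a crossing. *)
Definition crosses (R : realType) (G : sgraph) (D : drawing R G)
    (e f : edge G) : Prop :=
  e <> f /\ exists p, interior_points D e p /\ interior_points D f p.

Definition simple_drawing (R : realType) (G : sgraph) (D : drawing R G) : Prop :=
  (forall e f, adjacent_edges e f -> ~ crosses D e f) /\
  (forall e f p q, e <> f ->
     interior_points D e p -> interior_points D f p ->
     interior_points D e q -> interior_points D f q -> p = q).

Definition fan_crossing_free_drawing (R : realType) (G : sgraph)
    (D : drawing R G) : Prop :=
  forall e f g, adjacent_edges f g -> ~ (crosses D f e /\ crosses D g e).

Definition fan_crossing_drawing (R : realType) (G : sgraph)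
    (D : drawing R G) : Prop :=
  forall e, exists v : G, forall f, crosses D f e -> incident v f.

Definition k_planar_drawing (k : nat) (R : realType) (G : sgraph)
    (D : drawing R G) : Prop :=
  forall e, (#|[pred f : edge G | `[< crosses D f e >]]| <= k)%N.

(* In a simple drawing a crossing is determined by its unordered pair of edges,
   so an assignment of the crossings is a symmetric choice [a] of one edge from
   each crossing pair. *)
Definition k_gap_planar_drawing (k : nat) (R : realType) (G : sgraph)
    (D : drawing R G) : Prop :=
  exists a : edge G -> edge G -> edge G,
    (forall e f, crosses D e f ->
       a e f = a f e /\ (a e f = e \/ a e f = f)) /\
    (forall e,
       (#|[pred f : edge G | `[< crosses D e f >] && (a e f == e)]| <= k)%N).

Definition quasi_planar_drawing (R : realType) (G : sgraph)
    (D : drawing R G) : Prop :=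
  forall e f g, ~ [/\ crosses D e f, crosses D f g & crosses D e g].

Definition fan_crossing_free (R : realType) (G : sgraph) : Prop :=
  exists D : drawing R G, simple_drawing D /\ fan_crossing_free_drawing D.

Definition fan_crossing (R : realType) (G : sgraph) : Prop :=
  exists D : drawing R G, simple_drawing D /\ fan_crossing_drawing D.

Definition k_planar (k : nat) (R : realType) (G : sgraph) : Prop :=
  exists D : drawing R G, simple_drawing D /\ k_planar_drawing k D.

Definition k_gap_planar (k : nat) (R : realType) (G : sgraph) : Prop :=
  exists D : drawing R G, simple_drawing D /\ k_gap_planar_drawing k D.

Definition quasi_planar (R : realType) (G : sgraph) : Prop :=
  exists D : drawing R G, simple_drawing D /\ quasi_planar_drawing D.

Definition differ_exactly_at (d : nat) (x y : d.-tuple bool) (i : 'I_d) : bool :=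
  [forall j : 'I_d, (tnth x j != tnth y j) == (j == i)].

(* [ordS] is the cyclic successor on 'I_d.  The clause i != j only matters for
   d = 1, where it discards the loop; the cycles are genuine once 3 <= d. *)
Definition ccc_adj (d : nat) (u v : d.-tuple bool * 'I_d) : bool :=
  let: (x, i) := u in let: (y, j) := v in
  ((x == y) && (i != j) && ((j == ordS i) || (i == ordS j)))
  || ((i == j) && differ_exactly_at x y i).

Lemma ccc_adj_sym d : symmetric (@ccc_adj d).
Proof.
move=> [x i] [y j]; rewrite /ccc_adj.
rewrite [y == x]eq_sym [j == i]eq_sym [(i == ordS j) || _]orbC.
congr (_ || _); case: (i =P j) => //= <-.
by apply: eq_forallb => l; rewrite [tnth y l == _]eq_sym.
Qed.

Lemma ccc_adj_irrefl d : irreflexive (@ccc_adj d).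
Proof.
move=> [x i]; rewrite /ccc_adj !eqxx /=.
by apply/negbTE/forallPn; exists i; rewrite !eqxx.
Qed.

Definition CCC (d : nat) : sgraph := SGraph (@ccc_adj_sym d) (@ccc_adj_irrefl d).

(* Main.v *)
(** Lower bounds.  The van Kampen parity argument for K_{3,3} is run on
    epsilon-chains of points instead of on curves: if independent walks joining
    p_0, p_1, p_2 to q_0, q_1, q_2 stayed at distance at least 4 epsilon from each
    other, then counting, for every pair of independent walks, how often one walk
    passes through a horizontal ray issued from the endpoints of the other one
    would give a sum that is both even and odd.  Hence in every drawing two of the
    walks share a vertex or contain a pair of crossing edges.  Applied to the 2^d
    vertices (x,0) of CCC^d and to the walks that correct the bits one after the
    other, each vertex being on at most 3 * 2^d of these walks, this forces
    at least of the order of 4^d crossings, whereas a k-gap-planar drawing has only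
    O(k d 2^d) of them.  Since CCC^d is cubic, fan-crossing drawings are 3-planar.

    Upper bounds.  One straight-line drawing serves both.  Ordering the strings x by
    the reflected Gray code, the pairs {x, x with bit i flipped} are nested or
    disjoint for every i.  Each cycle is a thin triangle at abscissa rank(x), with
    level i at height about i, perturbed by the distance of the ranks in the pair:
    cycle edges never cross each other, and the other edges are horizontal segments
    that never cross each other either, so no three edges cross pairwise.  The signs
    of the perturbations at levels 0, 1, d-2, d-1 ensure that a horizontal segment
    crossing a cycle leaves at least two of its vertices on each side, hence never
    crosses two consecutive edges of it. *)
Require Import Defs.
From mathcomp Require Import all_boot all_order all_algebra.
From mathcomp Require Import all_classical all_reals all_analysis.
From mathcomp Require Import zify ring lra.
From Stdlib Require Import Btauto.

Set Implicit Arguments.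
Unset Strict Implicit.
Unset Printing Implicit Defensive.

Import Order.TTheory GRing.Theory Num.Theory.
Import numFieldNormedType.Exports.

Local Open Scope classical_set_scope.
Local Open Scope ring_scope.

(** * Crossing parities of chains of points *)

Section Parity.
Variable R : realType.
Implicit Types (o a b w : R * R) (s : seq (R * R)) (eps : R).

Definition near_pt eps a b := (`|a.1 - b.1| < eps) && (`|a.2 - b.2| < eps).

(** Lexicographic, by height and then abscissa: distinct points are always comparable, so no general
    position is required. *)
Definition above o a := (o.2 < a.2) || ((o.2 == a.2) && (o.1 < a.1)).

(** Testing the abscissa of [a] alone suffices: a short step that passes the height of a distant [o]
    lies entirely to one side of it. *)
Definition ray_cross o a b := (above o a (+) above o b) && (o.1 < a.1).

Fixpoint ray_parity o a s :=
  if s is b :: s' then ray_cross o a b (+) ray_parity o b s' else false.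

(* Crossings of the ray when the apex moves along a path and the target [w] is fixed. *)
Definition apex_cross w o o' := (above o w (+) above o' w) && (o.1 < w.1).

Fixpoint apex_parity w o s :=
  if s is o' :: s' then apex_cross w o o' (+) apex_parity w o' s' else false.

Lemma near_ptC eps a b : near_pt eps a b = near_pt eps b a.
Proof. by rewrite /near_pt distrC [`|a.2 - _|]distrC. Qed.

Lemma near_pt_bounds eps a b : near_pt eps a b ->
  [/\ a.1 < b.1 + eps, b.1 < a.1 + eps, a.2 < b.2 + eps & b.2 < a.2 + eps].
Proof.
rewrite /near_pt !ltr_norml => /andP[/andP[? ?] /andP[? ?]]; split; lra.
Qed.

Lemma far_cases eps o a : 0 < eps -> ~~ near_pt (4 * eps) o a ->
  [\/ o.2 + 3 * eps <= a.2, a.2 + 3 * eps <= o.2,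
      o.1 + 4 * eps <= a.1 | a.1 + 4 * eps <= o.1].
Proof.
move=> e0; rewrite /near_pt !ltr_norml => h.
have [h1|h1] := lerP (o.2 + 3 * eps) a.2; first by constructor 1.
have [h2|h2] := lerP (a.2 + 3 * eps) o.2; first by constructor 2.
have [h3|h3] := lerP (o.1 + 4 * eps) a.1; first by constructor 3.
have [h4|h4] := lerP (a.1 + 4 * eps) o.1; first by constructor 4.
exfalso; move/negP: h; apply; apply/andP; split; apply/andP; split; lra.
Qed.

Lemma aboveT o a : o.2 < a.2 -> above o a = true.
Proof. by rewrite /above => ->. Qed.

Lemma aboveF o a : a.2 < o.2 -> above o a = false.
Proof. by move=> h; rewrite /above ltNge (ltW h) /= gt_eqF. Qed.

(** If [a] is far from [o] vertically, all four comparisons agree. If it is far to the left, every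
    abscissa test fails. If it is far to the right, every test succeeds and each comparison occurs
    twice in the sum. *)
Lemma square_parity eps o o' a a' : 0 < eps -> near_pt eps o o' ->
    near_pt eps a a' -> ~~ near_pt (4 * eps) o a ->
  ray_cross o a a' (+) ray_cross o' a a' = apex_cross a o o' (+) apex_cross a' o o'.
Proof.
move=> e0 /near_pt_bounds[? ? ? ?] /near_pt_bounds[? ? ? ?] oa.
rewrite /ray_cross /apex_cross; case: (far_cases e0 oa) => h.
- by rewrite !aboveT //; lra.
- by rewrite !aboveF //; lra.
- have -> : o.1 < a.1 by lra.
  have -> : o'.1 < a.1 by lra.
  have -> : o.1 < a'.1 by lra.
  by case: above; case: above; case: above; case: above.
- have -> : (o.1 < a.1) = false by lra.
  have -> : (o'.1 < a.1) = false by lra.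
  have -> : (o.1 < a'.1) = false by lra.
  by rewrite !andbF.
Qed.

Lemma strip_parity eps o o' a s : 0 < eps -> near_pt eps o o' ->
    path (near_pt eps) a s -> all (fun b => ~~ near_pt (4 * eps) o b) (a :: s) ->
  ray_parity o a s (+) ray_parity o' a s =
  apex_cross a o o' (+) apex_cross (last a s) o o'.
Proof.
move=> e0 oo'; elim: s a => [|b s IH] a /=; first by rewrite addbb.
move=> /andP[ab ps] /andP[oa far].
by rewrite addbACA (square_parity e0 oo' ab oa) (IH _ ps far) -addbA addKb.
Qed.

(** A discrete Stokes formula: [square_parity], summed over all pairs of steps, telescopes to the
    boundary of the grid. *)
Lemma rectangle_parity eps o r a s : 0 < eps ->
    path (near_pt eps) o r -> path (near_pt eps) a s ->
    allrel (fun p b => ~~ near_pt (4 * eps) p b) (o :: r) (a :: s) ->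
  ray_parity o a s (+) ray_parity (last o r) a s =
  apex_parity a o r (+) apex_parity (last a s) o r.
Proof.
move=> e0; elim: r o => [|o' r IH] o; first by rewrite /= addbb.
rewrite [path _ _ (_ :: _)]/= allrel_consl => /andP[oo' pr] ps /andP[oa far].
rewrite /= addbACA -(IH _ pr ps far) -(strip_parity e0 oo' ps oa).
by rewrite addbA -[in RHS](addbA (ray_parity o _ _)) addbb addbF.
Qed.

Lemma above_swap o a : o != a -> above a o = ~~ above o a.
Proof.
case: o a => [x y] [z t]; rewrite xpair_eqE /above /=.
by case: (ltgtP y t) => //= _; case: (ltgtP x z).
Qed.

Lemma far_neq eps o a : 0 < eps -> ~~ near_pt (4 * eps) o a -> o != a.
Proof.
move=> e0; apply: contra => /eqP ->; rewrite /near_pt !subrr normr0.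
by rewrite andbb; lra.
Qed.

(* Seen from the target the ray points the other way, so the two counts together
   see every passage between "above" and "below". *)
Lemma apex_ray_parity eps w o s : 0 < eps -> path (near_pt eps) o s ->
    all (fun b => ~~ near_pt (4 * eps) w b) (o :: s) ->
  apex_parity w o s (+) ray_parity w o s = above w o (+) above w (last o s).
Proof.
move=> e0; elim: s o => [|o' s IH] o; first by rewrite /= addbb.
rewrite [path _ _ _]/= [all _ _]/= => /andP[oo' ps] /andP[wo far].
rewrite /= addbACA (IH _ ps far).
have wo' : ~~ near_pt (4 * eps) w o' by case/andP: far.
suff -> : apex_cross w o o' (+) ray_cross w o o' = above w o (+) above w o'.
  by rewrite -addbA addKb.
rewrite /apex_cross /ray_cross.
rewrite (above_swap (far_neq e0 wo)) (above_swap (far_neq e0 wo')).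
case: (near_pt_bounds oo') => ? ? ? ?; case: (far_cases e0 wo) => h.
- by rewrite !aboveT //; lra.
- by rewrite !aboveF //; lra.
- have -> : (w.1 < o.1) by lra.
  have -> : (o.1 < w.1) = false by lra.
  by case: above; case: above.
- have -> : (w.1 < o.1) = false by lra.
  have -> : (o.1 < w.1) by lra.
  by case: above; case: above.
Qed.

(** [apex_ray_parity] trades the apex counts left by [rectangle_parity] for ray counts; what remains
    depends only on the order of the four endpoints. *)
Lemma independent_pair_parity eps o r a s : 0 < eps ->
    path (near_pt eps) o r -> path (near_pt eps) a s ->
    allrel (fun p b => ~~ near_pt (4 * eps) p b) (o :: r) (a :: s) ->
  ray_parity o a s (+) ray_parity (last o r) a s (+)
    (ray_parity a o r (+) ray_parity (last a s) o r) =
  above a o (+) above a (last o r) (+)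
    (above (last a s) o (+) above (last a s) (last o r)).
Proof.
move=> e0 pr ps far.
have sub w : w \in a :: s -> all (fun b => ~~ near_pt (4 * eps) w b) (o :: r).
  move=> ws; apply/allP => b br; rewrite near_ptC.
  by move/allrelP: far; apply.
rewrite (rectangle_parity e0 pr ps far) addbACA.
by rewrite !(apex_ray_parity e0 pr) // sub ?mem_head ?mem_last.
Qed.

(** Otherwise [independent_pair_parity] can be summed over the 18 pairs of independent edges. Each
    ray count then occurs twice, as one index stays free, and every comparison involving some [p i]
    occurs an even number of times. Each of the three pairs of [q j] contributes its two opposite
    comparisons, of sum 1, once for each of the three pairs of rows: an odd total of 9. *)
Lemma K33_chains_close eps (p q : 'I_3 -> R * R) (c : 'I_3 -> 'I_3 -> seq (R * R)) :
  0 < eps ->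
  (forall i j, path (near_pt eps) (p i) (c i j)) ->
  (forall i j, last (p i) (c i j) = q j) ->
  exists i j i' j', [/\ i != i', j != j' &
    ~~ allrel (fun a b => ~~ near_pt (4 * eps) a b) (p i :: c i j) (p i' :: c i' j')].
Proof.
move=> e0 pc lc; apply: contrapT => none.
have far i j i' j' : i != i' -> j != j' ->
    allrel (fun a b => ~~ near_pt (4 * eps) a b) (p i :: c i j) (p i' :: c i' j').
  by move=> ii' jj'; apply: contrapT => /negP h; apply: none; exists i, j, i', j'.
have key i j i' j' (ii' : i != i') (jj' : j != j') :=
  independent_pair_parity e0 (pc i j) (pc i' j') (far _ _ _ _ ii' jj').
pose i0 : 'I_3 := Ordinal (isT : 0 < 3)%N.
pose i1 : 'I_3 := Ordinal (isT : 1 < 3)%N.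
pose i2 : 'I_3 := Ordinal (isT : 2 < 3)%N.
have qq j j' : j != j' -> above (q j') (q j) = ~~ above (q j) (q j').
  move=> jj'; apply: above_swap; apply: (far_neq e0).
  rewrite -(lc i0 j) -(lc i1 j').
  by have /allrelP := far i0 j i1 j' isT jj'; apply; rewrite mem_last.
have add (x y z t : bool) : x = y -> z = t -> x (+) z = y (+) t by move=> -> ->.
have pairs i i' (ii' : i != i') :=
  add _ _ _ _ (key i i0 i' i1 ii' isT) (add _ _ _ _ (key i i1 i' i0 ii' isT)
  (add _ _ _ _ (key i i0 i' i2 ii' isT) (add _ _ _ _ (key i i2 i' i0 ii' isT)
  (add _ _ _ _ (key i i1 i' i2 ii' isT) (key i i2 i' i1 ii' isT))))).
have := add _ _ _ _ (pairs i0 i1 isT)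
  (add _ _ _ _ (pairs i0 i2 isT) (pairs i1 i2 isT)).
rewrite !lc !(qq i0 i1) // !(qq i0 i2) // !(qq i1 i2) //.
have xE (x y : bool) : x (+) y = xorb x y by case: x; case: y.
rewrite !xE; set L := (X in X = _ -> _); set M := (X in _ = X -> _).
have -> : L = false by rewrite /L; btauto.
by have -> : M = true by rewrite /M; btauto.
Qed.
End Parity.

(** * Walks in drawings *)

Section Curves.
Variable R : realType.
Implicit Types (f g : R -> R * R) (eps : R).

Lemma near_ptE eps (a b : R * R) : near_pt eps a b = (`|a - b| < eps).
Proof. by rewrite prod_normE gt_max. Qed.

Lemma near_pt_ball eps (a b : R * R) : near_pt eps a b <-> ball a eps b.
Proof. by rewrite near_ptE ball_prod_normE. Qed.

Lemma disjoint_curves_far f g :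
  {within `[0%R, 1%R], continuous f} -> {within `[0%R, 1%R], continuous g} ->
  (forall s t, 0 <= s <= 1 -> 0 <= t <= 1 -> f s <> g t) ->
  exists2 del, 0 < del &
    forall s t, 0 <= s <= 1 -> 0 <= t <= 1 -> ~~ near_pt del (f s) (g t).
Proof.
move=> cf cg fg.
have /compact_EVT_min h : compact ((f @` `[0%R, 1%R]) `*` (g @` `[0%R, 1%R])).
  by apply: compact_setX; apply: continuous_compact => //; exact: segment_compact.
have I0 : `[0%R, 1%R]%classic (0 : R) by rewrite /= in_itv /= lexx ler01.
have /h{h}h : (f @` `[0%R, 1%R]) `*` (g @` `[0%R, 1%R]) !=set0.
  by exists (f 0, g 0); split; exists 0.
have /h{h}[[a b]] : {within (f @` `[0%R, 1%R]) `*` (g @` `[0%R, 1%R]),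
    continuous (fun z => `|z.1 - z.2|)}.
  apply: continuous_subspaceT => z; apply: cvg_norm; apply: cvgB.
    exact: cvg_fst.
  exact: cvg_snd.
rewrite inE => -[[s Is <-] [t It <-]] /= h; exists `|f s - g t|.
  rewrite normr_gt0 subr_eq0; apply/eqP; apply: fg.
    by move: Is; rewrite /= in_itv.
  by move: It; rewrite /= in_itv.
move=> s' t' Is' It'; rewrite near_ptE -leNgt.
by apply: (h (f s', g t')); rewrite inE; split;
  [exists s' | exists t'] => //; rewrite /= in_itv.
Qed.

(** The points reachable by chains inside the curve form a nonempty subset of its image that is
    relatively open and closed, and the image is connected. *)
Lemma curve_chain f eps : 0 < eps -> {within `[0%R, 1%R], continuous f} ->
  exists s, [/\ path (near_pt eps) (f 0) s, last (f 0) s = f 1 &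
    forall x, x \in f 0 :: s -> exists2 t, 0 <= t <= 1 & x = f t].
Proof.
move=> e0 cf; pose S := f @` `[0%R, 1%R].
have S0 : S (f 0) by exists 0 => //; rewrite /= in_itv /= lexx ler01.
have S1 : S (f 1) by exists 1 => //; rewrite /= in_itv /= lexx ler01.
have cS : connected S.
  by apply: connected_continuous_connected => //; exact: segment_connected.
pose B := [set p | S p /\ exists s, [/\ path (near_pt eps) (f 0) s,
    last (f 0) s = p & forall x, x \in f 0 :: s -> S x]].
have Bstep p x : B p -> S x -> near_pt eps p x -> B x.
  move=> [_ [s [ps ls Ss]]] Sx px; split=> //; exists (rcons s x).
  rewrite rcons_path ps last_rcons ls px; split=> // y.
  by rewrite -rcons_cons mem_rcons inE => /orP[/eqP ->|/Ss].
have B0 : B (f 0).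
  by split=> //; exists [::]; split=> // x; rewrite inE => /eqP ->.
have BS : B = S.
  apply: cS; first by exists (f 0).
  - exists (\bigcup_(p in B) ball p eps).
      by apply: bigcup_open => p _; exact: ball_open.
    apply/seteqP; split=> [p Bp|x [Sx [p Bp /near_pt_ball px]]].
      by split; [case: Bp | exists p => //; exact: ballxx].
    exact: Bstep Bp Sx px.
  - exists (~` \bigcup_(p in S `\` B) ball p eps).
      by apply: open_closedC; apply: bigcup_open => p _; exact: ball_open.
    apply/seteqP; split=> [p Bp|x [Sx nx]].
      split; first by case: Bp.
      move=> [x [Sx nBx] /near_pt_ball px]; apply: nBx.
      by apply: (Bstep p) => //; rewrite near_ptC.
    by apply: contrapT => nBx; apply: nx; exists x => //; exact: ballxx.
have [_ [s [ps ls Ss]]] : B (f 1) by rewrite BS.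
exists s; split=> // x /Ss[t It <-]; exists t => //.
Qed.

Lemma uniform_threshold (T : finType) (P : T -> R -> Prop) :
  (forall x a b, a <= b -> P x b -> P x a) ->
  (forall x, exists2 a, 0 < a & P x a) -> exists2 a, 0 < a & forall x, P x a.
Proof.
move=> mono ex.
suff [a a0 h] : exists2 a, 0 < a & forall x, x \in enum T -> P x a.
  by exists a => // x; apply: h; rewrite mem_enum.
elim: (enum T) => [|x s [a a0 IH]]; first by exists 1.
have [b b0 Pb] := ex x; exists (Num.min a b); first by rewrite lt_min a0 b0.
move=> y; rewrite inE => /orP[/eqP -> |/IH].
  by apply: mono Pb; rewrite ge_min lexx orbT.
by apply: mono; rewrite ge_min lexx.
Qed.

End Curves.

Section WalksInDrawings.
Variables (R : realType) (G : sgraph) (D : drawing R G).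
Implicit Types (u v : G) (e f : edge G).

(* Walks may pause: this lets a routing skip a step without changing its shape. *)
Definition lazy_adj u v := (u == v) || adj u v.

(** A walk made of pauses alone still occupies its vertex, so a vertex counts as a constant
    curve. *)
Definition item_curve (it : G + edge G) : R -> R * R :=
  match it with inl v => fun=> point_of D v | inr e => edge_arc D e end.

Definition item_support (it : G + edge G) : {set G} :=
  match it with inl v => [set v]%SET | inr e => val e end.

(** For a crossing, the ends of the two edges are recorded as lying on the walks, since congestion
    counts walks through vertices. *)
Definition touch (W W' : {pred G}) : Prop :=
  (exists v, v \in W /\ v \in W') \/
  (exists e f, [/\ crosses D e f, {subset val e <= W} & {subset val f <= W'}]).

Lemma item_curve_continuous it : {within `[0%R, 1%R], continuous (item_curve it)}.
Proof.
case: it => [v|e] /=; last exact: arc_continuous.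
by apply: continuous_subspaceT => x; exact: cvg_cst.
Qed.

Lemma arc_point e (t : R) : 0 <= t <= 1 ->
  (exists2 v, v \in val e & edge_arc D e t = point_of D v) \/
  interior_points D e (edge_arc D e t).
Proof.
move=> /andP[t0 t1]; have [u [v [eE a0 a1]]] := arc_ends D e.
have [->|n0] := eqVneq t 0; first by left; exists u => //; rewrite eE !inE eqxx.
have [->|n1] := eqVneq t 1.
  by left; exists v => //; rewrite eE !inE eqxx orbT.
by right; exists t => //; rewrite /= in_itv /= lt_neqAle eq_sym n0 t0 lt_neqAle n1.
Qed.

Lemma interior_not_point e v x : interior_points D e x -> x <> point_of D v.
Proof.
by move=> [t]; rewrite /= in_itv /= => t01 <-; exact: arc_avoids_vertices.
Qed.

Lemma items_disjoint (W W' : {pred G}) it it' : ~ touch W W' ->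
  {subset item_support it <= W} -> {subset item_support it' <= W'} ->
  forall s t, 0 <= s <= 1 -> 0 <= t <= 1 -> item_curve it s <> item_curve it' t.
Proof.
move=> nt sW sW' s t s01 t01 E.
have vv u v : u \in W -> v \in W' -> point_of D u <> point_of D v.
  by move=> uW vW' /point_of_inj uv; apply: nt; left; exists v; rewrite -{1}uv.
have ipoint i r : 0 <= r <= 1 ->
    (exists2 v, v \in item_support i & item_curve i r = point_of D v) \/
    (exists2 e, i = inr e & interior_points D e (item_curve i r)).
  case: i => [v|e] /= r01; first by left; exists v; rewrite ?inE.
  by case: (arc_point e r01) => [|h]; [left | right; exists e].
case: (ipoint it s s01) => [[u uit Eu]|[e ite pe]];
  case: (ipoint it' t t01) => [[v vit Ev]|[f itf pf]].
- by apply: (vv u v); [exact: sW | exact: sW' | rewrite -Eu E].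
- by apply: (interior_not_point pf); rewrite -E Eu.
- by apply: (interior_not_point pe); rewrite E Ev.
(* A common interior point of a single edge is no crossing, but then both walks contain the ends of
   that edge. *)
- have [ef|/eqP ef] := eqVneq e f; last first.
    apply: nt; right; exists e, f; split; last by rewrite itf in sW'.
      by split=> //; exists (item_curve it s); split=> //; rewrite E.
    by rewrite ite in sW.
  have [a [b [eE _ _]]] := arc_ends D e.
  apply: nt; left; exists a; split.
    by apply: sW; rewrite ite /= eE !inE eqxx.
  by apply: sW'; rewrite itf /= -ef eE !inE eqxx.
Qed.

Lemma set2_eq (T : finType) (u v a b : T) : u != v ->
  [set u; v]%SET = [set a; b]%SET -> (a = u /\ b = v) \/ (a = v /\ b = u).
Proof.
move=> uv /setP E.
have := E u; have := E v; rewrite !inE !eqxx orbT /=.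
move=> /esym/orP va /esym/orP ua.
case: va => /eqP vE; case: ua => /eqP uE; try by [left|right].
  by rewrite uE vE eqxx in uv.
by rewrite uE vE eqxx in uv.
Qed.

Lemma adj_edge u v : adj u v -> exists e : edge G, val e = [set u; v]%SET.
Proof.
move=> uv; have ie : is_edge [set u; v]%SET.
  by apply/existsP; exists u; apply/existsP; exists v; rewrite uv eqxx.
by exists (exist (fun s => is_edge s) _ ie).
Qed.

Lemma path_rev_near eps (a : R * R) s : path (near_pt eps) a s ->
  path (near_pt eps) (last a s) (rev (belast a s)).
Proof. by rewrite rev_path; apply: sub_path => x y; rewrite near_ptC. Qed.

Lemma adj_chain eps u v : 0 < eps -> adj u v ->
  exists s, [/\ path (near_pt eps) (point_of D u) s,
    last (point_of D u) s = point_of D v &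
    forall x, x \in point_of D u :: s -> exists e t,
      [/\ val e = [set u; v]%SET, 0 <= t <= 1 & x = edge_arc D e t]].
Proof.
move=> e0 uv.
have [e uvE] := adj_edge uv.
have [s [ps ls Is]] := curve_chain e0 (@arc_continuous _ _ D e).
have [a [b [eE a0 a1]]] := arc_ends D e.
have nuv : u != v by apply: contraTneq uv => ->; rewrite adj_irrefl.
have [[ua vb]|[ub va]] : (a = u /\ b = v) \/ (a = v /\ b = u).
  by apply: set2_eq nuv _; rewrite -uvE.
- exists s; rewrite -ua -vb -a0 -a1; split=> // x /Is[t t01 ->].
  by exists e, t; rewrite eE.
- 
  (* Here the arc runs from [v] to [u], so its chain is reversed. *)
  exists (rev (belast (edge_arc D e 0) s)); rewrite -ub -va -a0 -a1 -ls; split.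
  + exact: path_rev_near.
  + by case: (s) => //= y s'; rewrite rev_cons last_rcons.
  + move=> x; rewrite -rev_rcons mem_rev -lastI => /Is[t t01 ->].
    by exists e, t; rewrite eE finset.setUC.
Qed.

Lemma walk_chain eps u w : 0 < eps -> path lazy_adj u w ->
  exists s, [/\ path (near_pt eps) (point_of D u) s,
    last (point_of D u) s = point_of D (last u w) &
    forall x, x \in point_of D u :: s -> exists it t,
      [/\ {subset item_support it <= u :: w}, 0 <= t <= 1 & x = item_curve it t]].
Proof.
move=> e0; elim: w u => [|v w IH] u /=.
  move=> _; exists [::]; split=> // x; rewrite inE => /eqP ->.
  by exists (inl u), 0; rewrite lexx ler01; split=> // v; rewrite !inE.
move=> /andP[uv /IH[s [ps ls Is]]].
have sub it : {subset item_support it <= v :: w} ->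
    {subset item_support it <= [:: u, v & w]}.
  by move=> h z /h; rewrite (in_cons u) => ->; rewrite orbT.
case/predU1P: uv sub => [->|uv] sub.
  by exists s; split=> // x /Is[it [t [h ? ?]]]; exists it, t; split=> //; exact: sub.
have [r [pr lr Ir]] := adj_chain e0 uv.
exists (r ++ s); rewrite cat_path last_cat lr pr ps; split=> // x.
rewrite -cat_cons mem_cat => /orP[/Ir[e [t [eE t01 ->]]]|xs].
  exists (inr e), t; split=> // z /=; rewrite eE !inE.
  by case/orP => ->; rewrite ?orbT.
have /Is[it [t [h ? ?]]] : x \in point_of D v :: s by rewrite inE xs orbT.
by exists it, t; split=> //; exact: sub.
Qed.

(** Only finitely many pairs of vertices and edges occur, so one threshold [del] separates all pairs
    of disjoint curves. If no two independent walks touched, chains of step [del / 4] along them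
    would contradict [K33_chains_close]. *)
Lemma K33_walks_touch (p q : 'I_3 -> G) (w : 'I_3 -> 'I_3 -> seq G) :
  (forall i j, path lazy_adj (p i) (w i j)) ->
  (forall i j, last (p i) (w i j) = q j) ->
  exists i j i' j', [/\ i != i', j != j' &
    touch [in p i :: w i j] [in p i' :: w i' j']].
Proof.
move=> pw lw; apply: contrapT => none.
pose far (ii : (G + edge G) * (G + edge G)) (del : R) :=
  (forall s t, 0 <= s <= 1 -> 0 <= t <= 1 ->
     item_curve ii.1 s <> item_curve ii.2 t) ->
  forall s t, 0 <= s <= 1 -> 0 <= t <= 1 ->
    ~~ near_pt del (item_curve ii.1 s) (item_curve ii.2 t).
have [del del0 sep] : exists2 del, 0 < del & forall ii, far ii del.
  apply: uniform_threshold => [ii a b ab h dis s t s01 t01|ii].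
    apply: contra (h dis s t s01 t01); rewrite !near_ptE => /lt_le_trans; exact.
  have [dis|ndis] := pselect (forall s t, 0 <= s <= 1 -> 0 <= t <= 1 ->
     item_curve ii.1 s <> item_curve ii.2 t); last by exists 1.
  have [a a0 h] := disjoint_curves_far (@item_curve_continuous ii.1)
    (@item_curve_continuous ii.2) dis.
  by exists a => // _.
pose eps := del / 4; have e0 : 0 < eps by rewrite /eps; lra.
have dE : 4 * eps = del by rewrite /eps; lra.
pose chain i j s := [/\ path (near_pt eps) (point_of D (p i)) s,
  last (point_of D (p i)) s = point_of D (q j) &
  forall x, x \in point_of D (p i) :: s -> exists it t,
    [/\ {subset item_support it <= p i :: w i j}, 0 <= t <= 1
      & x = item_curve it t]].
have [c cP] : exists c : 'I_3 -> 'I_3 -> seq (R * R), forall i j, chain i j (c i j).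
  have ex i j : {s | chain i j s}.
    by apply: cid; have := walk_chain e0 (pw i j); rewrite lw.
  by exists (fun i j => projT1 (ex i j)) => i j; exact: (projT2 (ex i j)).
have pc i j : path (near_pt eps) (point_of D (p i)) (c i j) by case: (cP i j).
have lc i j : last (point_of D (p i)) (c i j) = point_of D (q j).
  by case: (cP i j).
have [i [j [i' [j' [ii' jj' /negP]]]]] := K33_chains_close e0 pc lc; apply.
apply/allrelP => x y.
case: (cP i j) => _ _ /[apply] -[it [s [sub s01 ->]]].
case: (cP i' j') => _ _ /[apply] -[it' [t [sub' t01 ->]]].
rewrite dE; apply: (sep (it, it')) => //.
apply: (@items_disjoint [in p i :: w i j] [in p i' :: w i' j']) => //.
by move=> h; apply: none; exists i, j, i', j'.
Qed.

End WalksInDrawings.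

(** * Counting and routing in cube-connected cycles *)

Section Counting.
Local Open Scope nat_scope.

Lemma card_cover (T I : finType) (P : pred T) (S : I -> pred T) :
  (forall x, P x -> exists i, S i x) -> #|P| <= \sum_i #|S i|.
Proof.
move=> cov; rewrite -sum1_card.
have -> : \sum_i #|S i| = \sum_(x : T) \sum_i (S i x : nat).
  rewrite exchange_big; apply: eq_bigr => i _.
  by rewrite -sum1_card big_mkcond; apply: eq_bigr => x _; rewrite unfold_in; case: (S i x).
rewrite big_mkcond; apply: leq_sum => x _; rewrite unfold_in.
case: ifP => // /cov[i Si]; by rewrite (bigD1 i) //= Si.
Qed.

Lemma card_cover_le (T I : finType) (P : pred T) (S : I -> pred T) c :
  (forall x, P x -> exists i, S i x) -> (forall i, #|S i| <= c) -> #|P| <= #|I| * c.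
Proof.
move=> cov le; apply: leq_trans (card_cover cov) _.
by rewrite -sum_nat_const; apply: leq_sum.
Qed.

Lemma card_pair_le (A B : finType) (P : pred A) (Q : pred B) a b :
  #|P| <= a -> #|Q| <= b -> #|[pred z : A * B | P z.1 && Q z.2]| <= a * b.
Proof.
move=> Pa Qb; have -> : #|[pred z : A * B | P z.1 && Q z.2]| = #|P| * #|Q|.
  by rewrite -cardX; apply: eq_card.
exact: leq_mul.
Qed.

Lemma I3_third (i i' : 'I_3) : i != i' -> exists k, forall l, [\/ l = i, l = i' | l = k].
Proof.
have I3 (l : 'I_3) : [\/ l = inord 0, l = inord 1 | l = inord 2].
  case: l => [[|[|[|//]]]] p; [constructor 1|constructor 2|constructor 3];
    by apply/val_inj; rewrite /= inordK.
move=> ii'; have := I3 i; have := I3 i'.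
case=> E' [] E; move: ii'; rewrite E E' ?eqxx // => _;
  by [exists (inord 0) => l; case: (I3 l) => ->; by [constructor 1|constructor 2|constructor 3]
     |exists (inord 1) => l; case: (I3 l) => ->; by [constructor 1|constructor 2|constructor 3]
     |exists (inord 2) => l; case: (I3 l) => ->; by [constructor 1|constructor 2|constructor 3]].
Qed.

(** Averaging over all choices of two triples: each choice has a quadruple in [P] at one of 81
    positions, and fixing the position and the quadruple leaves only two entries free. Hence |T|^6
    <= 81 |P| |T|^2. *)
Lemma K33_density (T : finType) (P : pred ((T * T) * (T * T))) :
  (forall X Y : {ffun 'I_3 -> T}, exists i j i' j',
     [/\ i != i', j != j' & P ((X i, Y j), (X i', Y j'))]) ->
  #|T| ^ 4 <= 81 * #|P|.
Proof.
move=> H.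
have [T0|T0] := posnP #|T|; first by rewrite T0.
pose S (k : ('I_3 * 'I_3) * ('I_3 * 'I_3)) (Z : {ffun 'I_3 -> T} * {ffun 'I_3 -> T}) :=
  [&& k.1.1 != k.2.1, k.1.2 != k.2.2 &
      P ((Z.1 k.1.1, Z.2 k.1.2), (Z.1 k.2.1, Z.2 k.2.2))].
have cov Z : predT Z -> exists k, S k Z.
  move=> _; have [i [j [i' [j' [ii' jj' h]]]]] := H Z.1 Z.2.
  by exists ((i, j), (i', j')); apply/and3P.
have le k : #|S k| <= #|P| * #|T| ^ 2.
  have [ii'|ii'] := eqVneq k.1.1 k.2.1.
    by rewrite eq_card0 // => Z; rewrite unfold_in /S ii' eqxx.
  have [jj'|jj'] := eqVneq k.1.2 k.2.2.
    by rewrite eq_card0 // => Z; rewrite unfold_in /S jj' eqxx andbF.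
  have [a Ha] := I3_third ii'; have [b Hb] := I3_third jj'.
  pose phi (Z : {ffun 'I_3 -> T} * {ffun 'I_3 -> T}) :=
    (((Z.1 k.1.1, Z.2 k.1.2), (Z.1 k.2.1, Z.2 k.2.2)), (Z.1 a, Z.2 b)).
  have inj : injective phi.
    move=> [X Y] [X' Y'] [] /= e1 e2 e3 e4 e5 e6.
    by congr (_, _); apply/ffunP => l; [case: (Ha l) | case: (Hb l)] => ->.
  rewrite -(fintype.card_image inj).
  apply: (@leq_trans #|[pred z : ((T * T) * (T * T)) * (T * T) | P z.1 && predT z.2]|).
    apply: subset_leq_card; apply/fintype.subsetP => z /fintype.imageP[Z].
    by rewrite unfold_in => /and3P[_ _ h] ->; rewrite inE /= andbT.
  by apply: card_pair_le => //; rewrite cardT -cardE card_prod mulnn.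
have := card_cover_le cov le.
rewrite card_prod !card_ffun !card_prod !card_ord.
by rewrite mulnA -expnD (expnD _ 4 2) leq_pmul2r // expn_gt0 T0.
Qed.

End Counting.

(** * Routes correcting the bits one by one, and their congestion *)

Section Routing.
Variable n : nat.
Local Notation d := n.+1.
Local Notation T := (d.-tuple bool).
Local Notation G := (CCC d).
Implicit Types (x y z : T) (i : 'I_d) (m : nat).
Local Open Scope nat_scope.

Definition flip_bit x i : T := [tuple tnth x j (+) (j == i) | j < d].

Lemma differ_exactly_atE x y i : differ_exactly_at x y i = (y == flip_bit x i).
Proof.
apply/forallP/eqP => [h|-> j]; last first.
  by rewrite tnth_mktuple; case: (tnth x j); case: (j == i).
apply: eq_from_tnth => j; rewrite tnth_mktuple.
by have /eqP <- := h j; case: (tnth x j); case: (tnth y j).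
Qed.

Definition mix x y m : T := [tuple if (j < m) then tnth y j else tnth x j | j < d].

(** Modulo [d], so that a route is back at level 0 once the last bit is corrected. *)
Definition level m : 'I_d := inord (m %% d).

Definition route x y m : seq G :=
  flatten [seq [:: (mix x y k.+1, level k); (mix x y k.+1, level k.+1)] | k <- iota 0 m].

Lemma mix0 x y : mix x y 0 = x.
Proof. by apply: eq_from_tnth => j; rewrite tnth_mktuple. Qed.

Lemma mix_full x y : mix x y d = y.
Proof. by apply: eq_from_tnth => j; rewrite tnth_mktuple ltn_ord. Qed.

Lemma val_level m : level m = m %% d :> nat.
Proof. by rewrite inordK // ltn_mod. Qed.

Lemma ordS_level m : ordS (level m) = level m.+1.
Proof. by apply: val_inj; rewrite /= !val_level -addn1 modnDml addn1. Qed.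

Lemma lazy_flip x y m : m < d ->
  lazy_adj ((mix x y m, level m) : G) (mix x y m.+1, level m).
Proof.
move=> md; rewrite /lazy_adj /adj /= /ccc_adj eqxx /= differ_exactly_atE.
have lm j : (j == level m) = (j == m :> nat) by rewrite -val_eqE /= val_level modn_small.
have [e|ne] := eqVneq (tnth x (level m)) (tnth y (level m)).
  suff -> : mix x y m.+1 = mix x y m by rewrite eqxx.
  apply: eq_from_tnth => j; rewrite !tnth_mktuple ltnS leq_eqVlt -lm.
  by have [->|//] := eqVneq j (level m); rewrite -e; case: ifP.
suff -> : mix x y m.+1 = flip_bit (mix x y m) (level m) by rewrite eqxx !orbT.
apply: eq_from_tnth => j; rewrite !tnth_mktuple ltnS leq_eqVlt -lm.
have [->|_] := eqVneq j (level m); last by rewrite addbF.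
rewrite /= val_level modn_small // ltnn addbT.
by move: ne; case: (tnth x _); case: (tnth y _).
Qed.

Lemma lazy_shift x m : lazy_adj ((x, level m) : G) (x, level m.+1).
Proof.
rewrite /lazy_adj /adj /= /ccc_adj eqxx /= -ordS_level eqxx /= andbT.
by rewrite xpair_eqE eqxx /=; case: eqVneq.
Qed.

Lemma route_path x y m : m <= d ->
  path (@lazy_adj G) (x, level 0) (route x y m) /\
  last (x, level 0) (route x y m) = (mix x y m, level m).
Proof.
elim: m => [|m IH] md; first by rewrite mix0.
have [p l] := IH (ltnW md).
have -> : route x y m.+1 = route x y m ++
    [:: (mix x y m.+1, level m); (mix x y m.+1, level m.+1)].
  have -> : route x y m.+1 = flatten [seq [:: (mix x y k.+1, level k);
      (mix x y k.+1, level k.+1)] | k <- iota 0 m ++ [:: m]].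
    by congr (flatten (map _ _)); rewrite -[m.+1]addn1 iotaD.
  by rewrite map_cat flatten_cat.
rewrite cat_path last_cat p l /=; split=> //.
by rewrite lazy_flip // lazy_shift.
Qed.

Lemma mem_route x y z i : (z, i) \in ((x, level 0) : G) :: route x y d ->
  [\/ z = mix x y i, z = mix x y i.+1 | z = mix x y d].
Proof.
rewrite inE => /orP[/eqP[-> ->]|/flatten_mapP[m]].
  by constructor 1; rewrite val_level mod0n mix0.
rewrite mem_iota add0n => /andP[_ md]; rewrite !inE => /orP[/eqP[-> ->]|/eqP[-> ->]].
  by constructor 2; rewrite val_level modn_small.
move: md; rewrite leq_eqVlt => /orP[/eqP ->|md]; first by constructor 3.
by constructor 1; rewrite val_level modn_small.
Qed.

(** The complementary mixture [mix y x m] consists of exactly the bits of [x] and [y] that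
    [mix x y m] omits, so together with [z] it determines the pair. *)
Lemma card_mix m z : #|[pred xy : T * T | mix xy.1 xy.2 m == z]| <= 2 ^ d.
Proof.
have -> : 2 ^ d = #|{: T}| by rewrite card_tuple card_bool.
apply: (@leq_card_in _ _ (fun xy : T * T => mix xy.2 xy.1 m)).
move=> [x y] [x' y']; rewrite !inE /= => /eqP <- /eqP e e'.
have E j := congr1 (fun t => tnth t j) e; have E' j := congr1 (fun t => tnth t j) e'.
congr (_, _); apply: eq_from_tnth => j; have := E j; have := E' j;
  by rewrite !tnth_mktuple; case: ifP.
Qed.

Lemma congestion (v : G) :
  #|[pred xy : T * T | v \in ((xy.1, level 0) : G) :: route xy.1 xy.2 d]| <= 3 * 2 ^ d.
Proof.
case: v => z i.
pose m (c : 'I_3) := tnth [tuple (i : nat); i.+1; d] c.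
have := @card_cover_le _ _
  [pred xy : T * T | (z, i) \in ((xy.1, level 0) : G) :: route xy.1 xy.2 d]
  (fun c => [pred xy | mix xy.1 xy.2 (m c) == z]) (2 ^ d).
rewrite card_ord; apply=> [[x y]|c]; last exact: card_mix.
rewrite inE /= => /mem_route[] ->; [exists ord0|exists (inord 1)|exists (inord 2)];
  by rewrite /m (tnth_nth 0) /= ?inordK.
Qed.

Definition next_on_cycle (v : G) : G := (v.1, ordS v.2).
Definition prev_on_cycle (v : G) : G := (v.1, ord_pred v.2).
Definition across (v : G) : G := (flip_bit v.1 v.2, v.2).

Lemma ccc_adjP (u v : G) :
  adj u v -> [\/ v = next_on_cycle u, u = next_on_cycle v | v = across u].
Proof.
case: u v => [x i] [y j]; rewrite /adj /= /ccc_adj.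
case/orP => [/andP[/andP[/eqP -> _] /orP[/eqP ->|/eqP ->]]|/andP[/eqP ->]].
- by constructor 1.
- by constructor 2.
- by rewrite differ_exactly_atE => /eqP ->; constructor 3.
Qed.

Lemma edgeP (e : edge G) : exists u v, adj u v /\ val e = [set u; v]%SET.
Proof.
by case: e => e /= /existsP[u /existsP[v /andP[uv /eqP ->]]]; exists u, v.
Qed.

Lemma card_val_edge (A : {set G}) : #|[pred e : edge G | val e == A]| <= 1.
Proof.
apply/card_le1_eqP => e f; rewrite !inE => /eqP eA /eqP fA.
by apply: val_inj; rewrite /= eA fA.
Qed.

Lemma card_CCC : #|G| = d * 2 ^ d.
Proof. by rewrite card_prod card_tuple card_bool card_ord mulnC. Qed.

Lemma card_edge : #|{: edge G}| <= 2 * (d * 2 ^ d).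
Proof.
pose S (c : G * bool) :=
  [pred e : edge G | val e == [set c.1; if c.2 then next_on_cycle c.1 else across c.1]%SET].
have := @card_cover_le _ _ predT S 1; rewrite card_prod card_bool card_CCC muln1.
rewrite mulnC; apply=> [e _|c]; last exact: card_val_edge.
have [u [v [/ccc_adjP h eE]]] := edgeP e; rewrite /S.
case: h eE => -> eE; [exists (u, true) | exists (v, true) | exists (u, false)];
  rewrite inE /= eE //.
by rewrite finset.setUC.
Qed.

Lemma card_incident (v : G) : #|[pred e : edge G | incident v e]| <= 3.
Proof.
pose N (c : 'I_3) := tnth [tuple next_on_cycle v; prev_on_cycle v; across v] c.
pose S c := [pred e : edge G | val e == [set v; N c]%SET].
have := @card_cover_le _ _ [pred e : edge G | incident v e] S 1.
rewrite card_ord; apply=> [e|c]; last exact: card_val_edge.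
rewrite inE /incident; have [a [b [ab eE]]] := edgeP e; rewrite eE.
have key u : adj v u -> exists c, N c = u.
  case/ccc_adjP => E; [exists ord0|exists (inord 1)|exists (inord 2)];
    rewrite /N (tnth_nth v) /= ?inordK //=.
  by rewrite E /prev_on_cycle /= ordSK -surjective_pairing.
rewrite !inE => /orP[] /eqP vE; [subst a | subst b].
  by have [c cE] := key _ ab; exists c; rewrite /S inE eE cE.
rewrite adj_sym in ab; have [c cE] := key _ ab; exists c.
by rewrite /S inE eE cE finset.setUC.
Qed.

End Routing.

(** * Lower bounds *)

Section LowerBounds.
Variable R : realType.
Local Open Scope nat_scope.

Lemma crosses_sym (G : sgraph) (D : drawing R G) e f : crosses D e f -> crosses D f e.
Proof. by case=> ne [x [? ?]]; split; [exact/nesym | exists x]. Qed.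

(** With N = 2^d, density gives N^4 <= 81 |P|. Each touching pair of walks is charged to one of the
    d N vertices or of the at most 4 k d N ordered crossing pairs, and each of these is charged at
    most (3 N)^2 times; 729 is 81 * 9. *)
Lemma k_gap_planar_CCC_bound n k : k_gap_planar k R (CCC n.+1) ->
  2 ^ n.+1 <= 729 * n.+1 * (1 + 4 * k).
Proof.
move=> [D [_ [a [aP gap]]]]; set d := n.+1; pose G := CCC d; pose T := d.-tuple bool.
pose walk (xy : T * T) : seq G := ((xy.1, level n 0) : G) :: route xy.1 xy.2 d.
pose P (z : (T * T) * (T * T)) := `[< touch D [in walk z.1] [in walk z.2] >].
pose crossing (ef : edge G * edge G) := `[< crosses D ef.1 ef.2 >].
have dense : #|{: T}| ^ 4 <= 81 * #|P|.
  apply: K33_density => X Y.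
  have := @K33_walks_touch R G D (fun i => (X i, level n 0))
    (fun j => (Y j, level n d)) (fun i j => route (X i) (Y j) d).
  case=> [i j|i j|i [j [i' [j' [ii' jj' h]]]]].
  - by have [] := route_path (X i) (Y j) (leqnn d).
  - by have [_ ->] := route_path (X i) (Y j) (leqnn d); rewrite mix_full.
  - by exists i, j, i', j'; split=> //; apply/asboolP.
have cross_le : #|crossing| <= 2 * #|{: edge G}| * k.
  (* The boolean tells which component of the ordered pair the crossing is assigned to. *)
  pose S (c : bool * edge G) (ef : edge G * edge G) := if c.1
    then (ef.1 == c.2) && (`[< crosses D c.2 ef.2 >] && (a c.2 ef.2 == c.2))
    else (`[< crosses D c.2 ef.1 >] && (a c.2 ef.1 == c.2)) && (ef.2 == c.2).
  rewrite -card_bool -card_prod; apply: (@card_cover_le _ _ _ S) => [[e f]|[b e]].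
    move/asboolP => /= ef; have [sym [aE|aE]] := aP _ _ ef.
      by exists (true, e); rewrite /S /= aE !eqxx andbT; apply/asboolP.
    exists (false, f); rewrite /S /= -sym aE !eqxx !andbT.
    by apply: asboolT; exact: crosses_sym.
  case: b.
    have := @card_pair_le _ _ (pred1 e) _ 1 k (eq_leq (card1 e)) (gap e).
    by rewrite mul1n.
  have := @card_pair_le _ _ _ (pred1 e) k 1 (gap e) (eq_leq (card1 e)).
  by rewrite muln1.
have repP (e : edge G) : exists v, v \in val e.
  by have [u [v [_ ->]]] := edgeP e; exists u; rewrite !inE eqxx.
pose rep e := xchoose (repP e).
have sq_le : #|P| <= (#|G| + #|crossing|) * (3 * 2 ^ d * (3 * 2 ^ d)).
  (* A shared vertex, or one chosen end of each crossing edge: the two walks must pass through these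
     two vertices. *)
  pose V (c : G + {ef : edge G * edge G | crossing ef}) : G * G := match c with
    | inl v => (v, v)
    | inr ef => (rep (val ef).1, rep (val ef).2) end.
  have -> : #|G| + #|crossing| = #|{: G + {ef : edge G * edge G | crossing ef}}|.
    by rewrite card_sum card_sig.
  apply: (@card_cover_le _ _ _
    (fun c => [pred z | ((V c).1 \in walk z.1) && ((V c).2 \in walk z.2)])) => [z|c].
    move/asboolP => [[v [vz vz']]|[e [f [ef ez fz]]]].
      by exists (inl v); rewrite inE /= vz vz'.
    have cef : crossing (e, f) by apply/asboolP.
    exists (inr (exist (fun ef => crossing ef) _ cef)); rewrite inE /=.
    by rewrite ez ?fz //; apply: xchooseP.
  exact: (@card_pair_le _ _ (fun xy => (V c).1 \in walk xy)
    (fun xy => (V c).2 \in walk xy) _ _ (congestion _) (congestion _)).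
have N0 : 0 < 2 ^ d by rewrite expn_gt0.
move: dense; rewrite card_tuple card_bool card_CCC in sq_le *.
have := card_edge n; rewrite -/d.
set N := 2 ^ d in N0 sq_le *; set m := #|{: edge G}| in cross_le *.
move=> mle dense.
have cle : #|crossing| <= 4 * k * (d * N).
  apply: leq_trans cross_le _.
  have -> : 4 * k * (d * N) = 2 * (2 * (d * N)) * k by ring.
  by rewrite leq_mul2r leq_mul2l mle !orbT.
rewrite -(leq_pmul2r (m := N ^ 3)) ?expn_gt0 ?N0 // -expnS.
apply: leq_trans dense _.
apply: (@leq_trans (81 * ((d * N + 4 * k * (d * N)) * (3 * N * (3 * N))))).
  by rewrite leq_mul2l /= (leq_trans sq_le) // leq_mul2r leq_add2l cle orbT.
by apply: eq_leq; rewrite !expnS expn0; ring.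
Qed.

Lemma k_planar_gap k (G : sgraph) : k_planar k R G -> k_gap_planar k R G.
Proof.
move=> [D [sD plan]]; exists D; split=> //.
(* Any symmetric choice will do; the enumeration of the edges provides one. *)
exists (fun e f => if enum_rank e <= enum_rank f then e else f); split.
  move=> e f _; split; last by case: leqP => _; [left | right].
  case: (ltngtP (enum_rank e) (enum_rank f)) => // ef.
  by apply: enum_rank_inj; apply: val_inj.
move=> e; apply: leq_trans (plan e); apply: subset_leq_card.
apply/fintype.subsetP => f; rewrite !inE => /andP[/asboolP ef _].
exact: crosses_sym.
Qed.

Lemma fan_crossing_3_planar n : fan_crossing R (CCC n.+1) -> k_planar 3 R (CCC n.+1).
Proof.
move=> [D [sD fan]]; exists D; split=> // e.
have [v h] := fan e; apply: leq_trans (card_incident v); apply: subset_leq_card.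
by apply/fintype.subsetP => f; rewrite !inE; exact: h.
Qed.

End LowerBounds.

(** * The reflected Gray code *)

Section GrayCode.
Local Open Scope nat_scope.
Implicit Types (s t : seq bool) (i : nat).

(** The rank of [s] in the reflected Gray code, leading bit first: a leading [true] selects the
    second half, listed backwards. *)
Fixpoint gray s : nat :=
  if s is b :: r then (if b then (2 ^ (size r).+1).-1 - gray r else gray r) else 0.

Fixpoint flip_nth s i : seq bool :=
  match s, i with
  | [::], _ => [::]
  | b :: r, 0 => ~~ b :: r
  | b :: r, j.+1 => b :: flip_nth r j
  end.

(** Truncated subtraction both ways gives the absolute difference of the two ranks. *)
Definition gray_width s i :=
  (gray s - gray (flip_nth s i)) + (gray (flip_nth s i) - gray s).

Lemma size_flip_nth s i : size (flip_nth s i) = size s.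
Proof. by elim: s i => [|b r IH] [|i] //=; rewrite IH. Qed.

Lemma flip_nthK s i : flip_nth (flip_nth s i) i = s.
Proof. by elim: s i => [|b r IH] [|i] //=; rewrite ?negbK ?IH. Qed.

Lemma nth_flip_nth s i j : j < size s ->
  nth false (flip_nth s i) j = nth false s j (+) (j == i).
Proof.
elim: s i j => [|b r IH] [|i] [|j] //= js; rewrite ?addbF ?addbT //.
exact: IH.
Qed.

Lemma gray_lt s : gray s < 2 ^ size s.
Proof.
elim: s => //= b r IH; rewrite expnS; case: b; lia.
Qed.

Lemma gray_inj s t : size s = size t -> gray s = gray t -> s = t.
Proof.
elim: s t => [|b r IH] [|c q] //= [sz].
have := gray_lt r; have := gray_lt q; rewrite -sz expnS => hq hr E.
have [bc rq] : b = c /\ gray r = gray q by case: b c E => [] [] E; split=> //; lia.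
by rewrite bc (IH q sz rq).
Qed.

(* Flipping bit [i] is a reflection of a block of Gray code ranks, so the pairs it
   matches are nested or disjoint. *)
Lemma gray_laminar s t i : size s = size t ->
  (gray s < gray t < gray (flip_nth s i) ->
     gray s < gray (flip_nth t i) < gray (flip_nth s i)) /\
  (gray (flip_nth s i) < gray t < gray s ->
     gray (flip_nth s i) < gray (flip_nth t i) < gray s).
Proof.
elim: s t i => [|b r IH] [|c q] i //=.
case=> sz; have hr := gray_lt r; have hq := gray_lt q.
(* Flipping the leading bit matches ranks of constant sum, so these pairs are concentric. *)
case: i => [|i] /=; first by rewrite -sz in hq *; rewrite !expnS; case: b; case: c => /=; lia.
have hr' := gray_lt (flip_nth r i); have hq' := gray_lt (flip_nth q i).
rewrite !size_flip_nth -sz in hr' hq hq' *; rewrite expnS.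
have [IH1 IH2] := IH q i sz.
(* With different leading bits [t] lies in the other half, outside the pair; with equal ones
   induction applies, its two cases being exchanged by the reversal when the bit is [true]. *)
by case: b; case: c => /=; split=> h; try lia;
  (have := IH1; have := IH2; clear - h hr hq hr' hq'; lia).
Qed.

Lemma gray_width_flip s i : gray_width (flip_nth s i) i = gray_width s i.
Proof. by rewrite /gray_width flip_nthK addnC. Qed.

Lemma gray_width_lt_exp s i : gray_width s i < 2 ^ size s.
Proof.
have := gray_lt s; have := gray_lt (flip_nth s i).
by rewrite size_flip_nth /gray_width; lia.
Qed.

Lemma gray_width_lt s t i : size s = size t ->
  gray s < gray t < gray (flip_nth s i) -> gray_width t i < gray_width s i.
Proof.
move=> sz h; have [/(_ h) h' _] := gray_laminar i sz.
by rewrite /gray_width; lia.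
Qed.

Lemma gray_width_le s t i : size s = size t ->
  gray s <= gray t <= gray (flip_nth s i) -> gray_width t i <= gray_width s i.
Proof.
move=> sz /andP[]; rewrite leq_eqVlt => /orP[/eqP/(gray_inj sz) -> //|h1].
rewrite leq_eqVlt => /orP[/eqP E|h2].
  by rewrite -(gray_width_flip s) (@gray_inj t (flip_nth s i)) // size_flip_nth.
by rewrite ltnW // gray_width_lt ?h1.
Qed.

Lemma val_flip_bit n (x : (n.+1).-tuple bool) (i : 'I_n.+1) :
  flip_bit x i = flip_nth x i :> seq bool.
Proof.
apply: (@eq_from_nth _ false); rewrite ?size_flip_nth !size_tuple // => j jn.
rewrite nth_flip_nth ?size_tuple // -[j]/(val (Ordinal jn)).
by rewrite -!tnth_nth tnth_mktuple.
Qed.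

End GrayCode.

(** * The drawing *)

Section StraightLine.
Variable R : realType.

Definition seg (a b : R * R) (t : R) : R * R :=
  (a.1 + t * (b.1 - a.1), a.2 + t * (b.2 - a.2)).

Lemma seg_rev a b t : seg a b t = seg b a (1 - t).
Proof. by rewrite /seg; congr (_, _); ring. Qed.

Lemma seg_continuous a b : continuous (seg a b).
Proof.
have affine (c m : R) : continuous (fun t : R => c + t * m).
  by move=> t; apply: cvgD; [exact: cvg_cst|apply: cvgM; [exact: cvg_id|exact: cvg_cst]].
by move=> t; exact: cvg_pair (affine _ _ t) (affine _ _ t).
Qed.

Lemma seg_inj a b : a <> b -> injective (seg a b).
Proof.
case: a b => [a1 a2] [b1 b2] ab s t [] /= /addrI e1 /addrI e2.
have [E1|n1] := eqVneq (b1 - a1) 0; last exact: mulIf e1.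
have [E2|n2] := eqVneq (b2 - a2) 0; last exact: mulIf e2.
by case: ab; congr (_, _); apply/esym/eqP; rewrite -subr_eq0 ?E1 ?E2.
Qed.

Lemma straight_line_drawing (G : sgraph) (P : G -> R * R) : injective P ->
  (forall u v w t, adj u v -> 0 < t < 1 -> seg (P u) (P v) t <> P w) ->
  exists D : drawing R G, forall e p, interior_points D e p ->
    exists u v t, [/\ adj u v, val e = [set u; v]%SET, 0 < t < 1
      & p = seg (P u) (P v) t].
Proof.
move=> Pinj avoid.
have ends (e : edge G) : {uv : G * G | adj uv.1 uv.2 /\ val e = [set uv.1; uv.2]%SET}.
  apply: cid; case: e => e /= /existsP[u /existsP[v /andP[uv /eqP ->]]].
  by exists (u, v).
pose h e := projT1 (ends e); have hP e := projT2 (ends e) : adj (h e).1 (h e).2 /\ _.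
pose arc e := seg (P (h e).1) (P (h e).2).
have arc_cont e : {within `[0%R, 1%R], continuous (arc e)}.
  by apply: continuous_subspaceT; exact: seg_continuous.
have arc_injective e : {in `[0%R, 1%R] &, injective (arc e)}.
  move=> s t _ _; apply: seg_inj => /Pinj E.
  by have [] := hP e; rewrite E adj_irrefl.
have arc_e e : exists u v : G,
    [/\ val e = [set u; v]%SET, arc e 0 = P u & arc e 1 = P v].
  exists (h e).1, (h e).2; split; first by have [] := hP e.
    by rewrite /arc /seg !mul0r !addr0 -surjective_pairing.
  by rewrite /arc /seg !mul1r !subrKC -surjective_pairing.
have arc_av e (t : R) (v : G) : 0 < t < 1 -> arc e t <> P v.
  by apply: avoid; have [] := hP e.
exists (Drawing Pinj arc_cont arc_injective arc_e arc_av) => e p [t].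
rewrite /= in_itv /= => t01 <-; have [ue eE] := hP e.
by exists (h e).1, (h e).2, t.
Qed.

End StraightLine.

(** * Placing the cube-connected cycle in the plane *)

Section CCCDrawing.
Variables (R : realType) (n : nat).
(** This makes the levels 0, 1, [n.-1] and [n], where the signs of the perturbations matter,
    distinct. *)
Hypothesis n3 : (3 <= n)%N.
Local Notation d := n.+1.
Local Notation T := (d.-tuple bool).
Local Notation G := (CCC d).
Implicit Types (x y z : T) (i j : 'I_d) (k l : nat) (e f : edge G) (p q : R * R).

(* At levels 0 and [n.-1] the outer pairs are the lower ones, so that a segment at
   level 0 or [n.-1] runs below the same level of the cycles that it crosses. *)
Definition height x k : nat :=
  if (k == 0)%N || (k == n.-1) then (k.+1 * 2 ^ d.+1 - gray_width x k)%N
  else (k.+1 * 2 ^ d.+1 + gray_width x k)%N.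

(** The cycle of [x] occupies the abscissas from [2 * gray x] to [2 * gray x + 1]; only its level 0
    vertex sits on the right side, which opens the cycle into a triangle. *)
Definition place (v : G) : R * R :=
  ((2 * gray v.1 + (v.2 == 0%N :> nat))%:R, (height v.1 v.2)%:R).

(** Levels are 2^(d+1) apart and perturbed by less than 2^d, so they occupy disjoint bands of
    heights. *)
Lemma height_bounds x k : (k.+1 * 2 ^ d.+1 - 2 ^ d < height x k < k.+1 * 2 ^ d.+1 + 2 ^ d)%N.
Proof.
have := gray_width_lt_exp x k; rewrite size_tuple => h.
have : (2 ^ d.+1 <= k.+1 * 2 ^ d.+1)%N by rewrite leq_pmull.
rewrite /height [X in (X <= _)%N]expnS; move: (k.+1 * _)%N => M hM.
by case: ifP => _; lia.
Qed.

Lemma height_lt x y k l : (k < l)%N -> (height x k < height y l)%N.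
Proof.
move=> kl; have /andP[_ h1] := height_bounds x k; have /andP[h2 _] := height_bounds y l.
have : (k.+2 * 2 ^ d.+1 <= l.+1 * 2 ^ d.+1)%N by rewrite leq_mul2r ltnS kl orbT.
move: h1 h2; rewrite [(k.+2 * _)%N]mulSn (expnS _ d); move: (k.+1 * _)%N (l.+1 * _)%N => M M'.
lia.
Qed.

Lemma height_inj x y k l : height x k = height y l ->
  k = l /\ gray_width x k = gray_width y l.
Proof.
move=> E; have [kl|lk|kl] := ltngtP k l.
- by have := height_lt x y kl; rewrite E ltnn.
- by have := height_lt y x lk; rewrite E ltnn.
split=> //; rewrite kl in E *.
have := gray_width_lt_exp x l; have := gray_width_lt_exp y l; rewrite !size_tuple.
have : (2 ^ d.+1 <= l.+1 * 2 ^ d.+1)%N by rewrite leq_pmull.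
move: E; rewrite /height [X in (X <= _)%N]expnS; move: (l.+1 * _)%N => M.
by case: ifP => _; lia.
Qed.

Lemma gray_tuple_inj x y : gray x = gray y -> x = y.
Proof. by move=> E; apply: val_inj; apply: gray_inj E; rewrite !size_tuple. Qed.

Lemma place_inj : injective place.
Proof.
move=> [x i] [y j] [] /= /eqP; rewrite eqr_nat => /eqP E1 /eqP.
rewrite eqr_nat => /eqP /height_inj[/val_inj ij _].
by rewrite (@gray_tuple_inj x y) ?ij //; lia.
Qed.

(** The edge [k = n] closes the cycle. It is parametrised from level 0, so that every edge rises
    with [t]. *)
Definition on_cycle_edge x k p := exists t : R, 0 < t < 1 /\
  if k == 0 then
    p = ((2 * gray x).+1%:R - t,
         (height x 0)%:R + t * ((height x 1)%:R - (height x 0)%:R))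
  else if k == n then
    p = ((2 * gray x).+1%:R - t,
         (height x 0)%:R + t * ((height x n)%:R - (height x 0)%:R))
  else
    p = ((2 * gray x)%:R,
         (height x k)%:R + t * ((height x k.+1)%:R - (height x k)%:R)).

(** Here [x] is the end of smaller rank, hence the left one. *)
Definition on_matching_edge x k p :=
  [/\ p.2 = (height x k)%:R, (2 * gray x + (k == 0%N))%:R < p.1 &
    p.1 < (2 * gray (flip_nth x k) + (k == 0%N))%:R].

Lemma val_ordS i : ordS i = (if i == n :> nat then 0 else i.+1)%N :> nat.
Proof.
have := ltn_ord i; rewrite /= ltnS leq_eqVlt; case: eqP => [-> _|_ /= h].
  by rewrite modnn.
by rewrite modn_small.
Qed.

Lemma between01_rev (t : R) : 0 < t < 1 -> 0 < 1 - t < 1.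
Proof. by move=> /andP[? ?]; apply/andP; split; lra. Qed.

Lemma seg_cycle x i (t : R) : 0 < t < 1 ->
  on_cycle_edge x i (seg (place (x, i)) (place (x, ordS i)) t).
Proof.
move=> t01; have vS : (i.+1 %% d)%N = _ := val_ordS i.
rewrite /on_cycle_edge /seg /place /= vS.
have [i0|i0] := eqVneq (i : nat) 0%N.
  exists t; split=> //; rewrite i0 /= ifF /= ?addn0 ?addn1; last lia.
  by congr (_, _); rewrite -natr1; ring.
have [iN|iN] := eqVneq (i : nat) n.
  exists (1 - t); split; first exact: between01_rev.
  by rewrite iN /= addn0 addn1 -natr1; congr (_, _); ring.
by exists t; split=> //; rewrite /= addn0; congr (_, _); ring.
Qed.

Lemma on_cycle_edge_x x k p : on_cycle_edge x k p ->
  (2 * gray x)%:R <= p.1 < (2 * gray x).+1%:R.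
Proof.
move=> [t [/andP[t0 t1]]]; rewrite -natr1.
by case: eqP => _; [|case: eqP => _] => -> /=; apply/andP; split; lra.
Qed.

Lemma on_cycle_edge_y x k p : (k <= n)%N -> on_cycle_edge x k p ->
  [/\ (height x (if k == n then 0 else k))%:R < p.2 &
      p.2 < (height x (if k == n then n else k.+1))%:R].
Proof.
move=> kn [t [/andP[t0 t1]]].
have lt a b (s : R) : (a < b)%N -> 0 < s -> s < 1 ->
    a%:R < a%:R + s * (b%:R - a%:R) < (b%:R : R).
  rewrite -(ltr_nat R) => ab s0 s1; apply/andP; split; nra.
have n0 : (0%N == n) = false by lia.
have [->|k0] := eqVneq k 0%N.
  by rewrite n0 => -> /=; apply/andP; apply: lt => //; apply: height_lt.
by have [kE|kN] := eqVneq k n; move=> -> /=; apply/andP; apply: lt => //;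
  apply: height_lt; lia.
Qed.

Lemma on_cycle_edge_unique x k p q : (k <= n)%N ->
  on_cycle_edge x k p -> on_cycle_edge x k q -> p.2 = q.2 -> p = q.
Proof.
move=> kn [t [t01 Hp]] [s [s01 Hq]].
have eqt a b (u v : R) : (a < b)%N ->
    a%:R + u * (b%:R - a%:R) = a%:R + v * (b%:R - a%:R) :> R -> u = v.
  rewrite -(ltr_nat R) => ab /addrI/mulIf; apply; apply/eqP; lra.
move: Hp Hq; case: eqP => [_|_] => [-> ->|] /=.
  by move=> /eqt -> //; apply: height_lt.
case: eqP => [_|_] -> -> /= /eqt -> //; apply: height_lt; lia.
Qed.

(** Distinct cycles have disjoint ranges of abscissas. Inside a cycle, the edges other than [n] are
    stacked by height. *)
Lemma cycle_edges_disjoint x y k l p : (k <= n)%N -> (l <= n)%N ->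
  on_cycle_edge x k p -> on_cycle_edge y l p -> x = y /\ k = l.
Proof.
move=> kn ln hk hl.
have xy : x = y.
  have /andP[] := on_cycle_edge_x hk; have /andP[] := on_cycle_edge_x hl.
  move=> a b a' b'; apply: gray_tuple_inj.
  have := le_lt_trans a b'; have := le_lt_trans a' b; rewrite !ltr_nat; lia.
split=> //; subst y.
wlog kl : k l kn ln hk hl / (k < l)%N.
  by move=> W; have [kl|lk|] := ltngtP k l; [exact: W kl | apply/esym; exact: W lk |].
exfalso; have [_ hky] := on_cycle_edge_y kn hk; have [hly _] := on_cycle_edge_y ln hl.
have k_n : (k == n) = false by lia.
rewrite k_n in hky.
have [lE|lE] := eqVneq l n; last first.
  rewrite (negbTE lE) in hly; have := lt_trans hly hky; rewrite ltr_nat.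
  have [->|kl'] := eqVneq k.+1 l; first by rewrite ltnn.
  by rewrite ltnNge ltnW // height_lt //; lia.
(* The closing edge lies strictly to the right of the vertical ones; it meets edge 0 only at their
   common end, since equal abscissas force equal parameters but the slopes differ. *)
subst l; move: hk hl => [t [/andP[t0 t1] Hk]] [s [/andP[s0 s1] Hl]].
have n0 : (n == 0%N) = false by lia.
rewrite n0 eqxx in Hl; rewrite k_n in Hk; rewrite Hl in Hk.
case: eqP Hk => [_|_] []; last by rewrite -natr1; lra.
move=> e1 /addrI; have -> : t = s by lra.
have : (height x 1)%:R < ((height x n)%:R : R) by rewrite ltr_nat height_lt //; lia.
by move=> h /mulfI; rewrite gt_eqF // => /(_ isT); lra.
Qed.

(** The rank of [x] lies between those of the matched pair, ends included, so laminarity compares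
    the widths. *)
Lemma matching_passes x z k p : (k <= n)%N -> on_matching_edge z k p ->
  (2 * gray x)%:R <= p.1 < (2 * gray x).+1%:R ->
  (gray_width x k <= gray_width z k)%N.
Proof.
move=> kn [_ a b] /andP[a' b']; apply: gray_width_le; first by rewrite !size_tuple.
have := lt_trans a b'; have := le_lt_trans a' b; rewrite !ltr_nat.
by case: (k == _); lia.
Qed.

(** Equal heights force equal level and width, whereas two distinct overlapping pairs of one level
    are nested with different widths. *)
Lemma matching_edges_disjoint x y k l p : on_matching_edge x k p ->
  on_matching_edge y l p -> x = y /\ k = l.
Proof.
move=> [h a b] [h' a' b']; move: h'; rewrite h => /eqP.
rewrite eqr_nat => /eqP /height_inj[kl wE]; subst l; split=> //.
have := lt_trans a b'; have := lt_trans a' b; rewrite !ltr_nat !ltn_add2r.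
rewrite !ltn_pmul2l // => yx xy.
have sz u v : size (u : T) = size (v : T) by rewrite !size_tuple.
have [lt|lt|/gray_tuple_inj //] := ltngtP (gray x) (gray y).
  by have := @gray_width_lt x y k (sz _ _); rewrite lt yx wE ltnn => /(_ isT).
by have := @gray_width_lt y x k (sz _ _); rewrite lt xy wE ltnn => /(_ isT).
Qed.

Lemma cycle_edge_avoids x y i k p :
  (k <= n)%N -> on_cycle_edge x k p -> p <> place (y, i).
Proof.
move=> kn hk E.
have E1 : p.1 = (2 * gray y + (i == 0%N :> nat))%:R by rewrite E.
have E2 : p.2 = (height y i)%:R by rewrite E.
have /andP[] := on_cycle_edge_x hk; rewrite E1 ler_nat ltr_nat => a b.
have xy : y = x by apply: gray_tuple_inj; lia.
have i0 : (i == 0%N :> nat) = false by move: a b; rewrite xy; case: (_ == _); lia.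
have [] := on_cycle_edge_y kn hk; rewrite E2 xy !ltr_nat => c c'.
case: hk => [t [/andP[t0 t1]]]; rewrite xy i0 addn0 in E1.
have [_ Ep|k0] := eqVneq k 0%N.
  by move: E1; rewrite Ep /= -natr1; lra.
have [_ Ep|kN _] := eqVneq k n.
  by move: E1; rewrite Ep /= -natr1; lra.
move: c c'; rewrite (negbTE kN) => c c'.
have [ik|ki|ik] := ltngtP i k.
- by have := height_lt x x ik; lia.
- move: ki; rewrite leq_eqVlt => /orP[/eqP ki|ki]; first by move: c'; rewrite ki ltnn.
  by have := height_lt x x ki; lia.
- by rewrite ik ltnn in c.
Qed.

Lemma matching_edge_avoids x y i k p : on_matching_edge x k p -> p <> place (y, i).
Proof.
move=> [h a b] E.
have E1 : p.1 = (2 * gray y + (i == 0%N :> nat))%:R by rewrite E.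
move: h; rewrite {1}E => /eqP; rewrite eqr_nat => /eqP /height_inj[ik wE]; subst k.
move: a b; rewrite E1 !ltr_nat !ltn_add2r !ltn_pmul2l // => a b.
have := @gray_width_lt x y i; rewrite a b wE ltnn !size_tuple.
by move=> /(_ erefl isT).
Qed.

Lemma seg_matching z i (t : R) : (gray z < gray (flip_bit z i))%N -> 0 < t < 1 ->
  on_matching_edge z i (seg (place (z, i)) (place (flip_bit z i, i)) t).
Proof.
move=> lt /andP[t0 t1]; rewrite /on_matching_edge /seg /place /= val_flip_bit in lt *.
have -> : height (flip_bit z i) i = height z i.
  by rewrite /height val_flip_bit gray_width_flip.
have : (2 * gray z + (i == 0%N :> nat))%:R <
    (2 * gray (flip_nth z i) + (i == 0%N :> nat))%:R :> R.
  by rewrite ltr_nat ltn_add2r ltn_pmul2l.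
move: (_%:R) (_%:R) => u v uv; split; first by rewrite subrr mulr0 addr0.
all: nra.
Qed.

Definition cycle_edge e x i := val e = [set ((x, i) : G); (x, ordS i)]%SET.

Definition matching_edge e z i :=
  (gray z < gray (flip_bit z i))%N /\ val e = [set ((z, i) : G); (flip_bit z i, i)]%SET.

Lemma flip_bitK x i : flip_bit (flip_bit x i) i = x.
Proof. by apply: val_inj; rewrite /= !val_flip_bit flip_nthK. Qed.

Lemma flip_bit_neq x i : gray (flip_bit x i) != gray x.
Proof.
apply/eqP => /gray_tuple_inj/(congr1 (fun y => tnth y i)).
by rewrite tnth_mktuple eqxx addbT; case: (tnth x i).
Qed.

Lemma edge_class e : (exists x i, cycle_edge e x i) \/ (exists z i, matching_edge e z i).
Proof.
have [[x i] [[y j] [/ccc_adjP uv eE]]] := edgeP e.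
case: uv eE => -> eE.
- by left; exists x, i.
- by left; exists y, j; rewrite /cycle_edge eE finset.setUC.
- right; have := flip_bit_neq x i; rewrite neq_ltn => /orP[lt|lt]; last by exists x, i.
  exists (flip_bit x i), i; split; first by rewrite flip_bitK.
  by rewrite flip_bitK eE finset.setUC.
Qed.

Lemma seg_on_edge e (u v : G) (t : R) : adj u v -> val e = [set u; v]%SET -> 0 < t < 1 ->
  (forall x i, cycle_edge e x i -> on_cycle_edge x i (seg (place u) (place v) t)) /\
  (forall z i, matching_edge e z i -> on_matching_edge z i (seg (place u) (place v) t)).
Proof.
move=> uv eE t01; have nuv : u != v by apply: contraTneq uv => ->; rewrite adj_irrefl.
split=> [x i E|z i [lt E]]; rewrite ?/cycle_edge eE in E;
  have [[<- <-]|[<- <-]] := set2_eq nuv E; rewrite 1?[seg (place (_, ordS _)) _ _]seg_rev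
   1?[seg (place (flip_bit _ _, _)) _ _]seg_rev.
- exact: seg_cycle.
- by apply: seg_cycle; exact: between01_rev.
- exact: seg_matching.
- by apply: seg_matching => //; exact: between01_rev.
Qed.

Lemma CCC_drawing : exists D : drawing R G, forall e p, interior_points D e p ->
  (forall x i, cycle_edge e x i -> on_cycle_edge x i p) /\
  (forall z i, matching_edge e z i -> on_matching_edge z i p).
Proof.
have [|D HD] := straight_line_drawing place_inj.
  move=> u v [y j] t uv t01; have [e eE] := adj_edge uv.
  have [hc hm] := seg_on_edge uv eE t01.
  have [[x [i /hc]]|[z [i /hm]]] := edge_class e.
    by apply: cycle_edge_avoids; rewrite -ltnS.
  exact: matching_edge_avoids.
exists D => e p /HD[u [v [t [uv eE t01 ->]]]]; exact: seg_on_edge.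
Qed.

(** * Crossings in the drawing *)

Section Properties.
Variable D : drawing R G.
Hypothesis DP : forall e p, interior_points D e p ->
  (forall x i, cycle_edge e x i -> on_cycle_edge x i p) /\
  (forall z i, matching_edge e z i -> on_matching_edge z i p).

Let on_c e x i p : cycle_edge e x i -> interior_points D e p -> on_cycle_edge x i p.
Proof. by move=> c /DP[h _]; exact: h. Qed.

Let on_m e x i p : matching_edge e x i -> interior_points D e p -> on_matching_edge x i p.
Proof. by move=> c /DP[_ h]; exact: h. Qed.

Let ord_n i : (i <= n)%N. Proof. by rewrite -ltnS. Qed.

Lemma cycle_edges_not_cross e f x y i j :
  cycle_edge e x i -> cycle_edge f y j -> ~ crosses D e f.
Proof.
move=> ce cf [ne [p [/(on_c ce) pe /(on_c cf) pf]]]; apply: ne; apply: val_inj.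
have [xy ij] := cycle_edges_disjoint (ord_n i) (ord_n j) pe pf.
by rewrite ce cf xy (val_inj ij).
Qed.

Lemma matching_edges_not_cross e f x y i j :
  matching_edge e x i -> matching_edge f y j -> ~ crosses D e f.
Proof.
move=> ce cf [ne [p [/(on_m ce) pe /(on_m cf) pf]]]; apply: ne; apply: val_inj.
have [xy ij] := matching_edges_disjoint pe pf.
by case: ce cf => _ -> [_ ->]; rewrite xy (val_inj ij).
Qed.

(** Among three edges, two are of the same kind and hence do not cross. *)
Lemma CCC_quasi_planar_drawing : quasi_planar_drawing D.
Proof.
move=> e f g [ef fg eg].
have [[x [i ce]]|[x [i ce]]] := edge_class e; have [[y [j cf]]|[y [j cf]]] := edge_class f;
  have [[z [l cg]]|[z [l cg]]] := edge_class g;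
  first [exact: (cycle_edges_not_cross ce cf ef) | exact: (matching_edges_not_cross ce cf ef)
   | exact: (cycle_edges_not_cross ce cg eg) | exact: (matching_edges_not_cross ce cg eg)
   | exact: (cycle_edges_not_cross cf cg fg) | exact: (matching_edges_not_cross cf cg fg)].
Qed.

Lemma mixed_point_unique e f x z i j p q : cycle_edge e x i -> matching_edge f z j ->
  interior_points D e p -> interior_points D f p ->
  interior_points D e q -> interior_points D f q -> p = q.
Proof.
move=> ce mf /(on_c ce) pe /(on_m mf)[pf _ _] /(on_c ce) qe /(on_m mf)[qf _ _].
by apply: (on_cycle_edge_unique _ pe qe) => //; rewrite pf qf.
Qed.

(** The segment lies at the height of the common vertex, while the interior of the cycle edge lies
    strictly between the heights of its ends. *)
Lemma cycle_matching_adjacent_not_cross e f x z i j v :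
  cycle_edge e x i -> matching_edge f z j -> incident v e -> incident v f ->
  ~ crosses D e f.
Proof.
move=> ce mf; rewrite /incident ce (proj2 mf) !inE.
case: v => y k ve vf [_ [p [/(on_c ce) pe /(on_m mf)[pf _ _]]]].
have {vf} hy : height z j = height y k.
  case/orP: vf => /eqP[-> ->] //.
  by rewrite /height val_flip_bit gray_width_flip.
have [] := on_cycle_edge_y (ord_n i) pe; rewrite pf hy !ltr_nat.
have vS : ordS i = _ :> nat := val_ordS i.
have n0 : (n == 0%N) = false by lia.
case/orP: ve => /eqP[-> ->]; rewrite ?vS; case: eqP => [iE|_]; rewrite ?iE ?ltnn //.
Qed.

Lemma CCC_simple_drawing : simple_drawing D.
Proof.
split=> [e f [ef [v [ve vf]]] cr|e f p q ef pe pf qe qf].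
  have [[x [i ce]]|[x [i ce]]] := edge_class e;
    have [[y [j cf]]|[y [j cf]]] := edge_class f.
  - exact: (cycle_edges_not_cross ce cf cr).
  - exact: (cycle_matching_adjacent_not_cross ce cf ve vf).
  - exact: (cycle_matching_adjacent_not_cross cf ce vf ve (crosses_sym cr)).
  - exact: (matching_edges_not_cross ce cf cr).
have cr : crosses D e f by split=> //; exists p.
have [[x [i ce]]|[x [i ce]]] := edge_class e;
  have [[y [j cf]]|[y [j cf]]] := edge_class f.
- by case: (cycle_edges_not_cross ce cf cr).
- exact: (mixed_point_unique ce cf).
- exact: (mixed_point_unique cf ce).
- by case: (matching_edges_not_cross ce cf cr).
Qed.

(** The height ranges of two consecutive edges overlap only at the lowest vertex ([i = n]) or the
    highest one ([i.+1 = n]). There the segment would have to run between levels 0 and 1, or between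
    [n.-1] and [n], of the cycle. By [matching_passes] its width is at least that of [x], so the
    signs in [height] put it outside that gap. *)
Lemma consecutive_not_both_crossed e f g x z i j :
  matching_edge e z j -> cycle_edge f x i -> cycle_edge g x (ordS i) ->
  crosses D f e -> crosses D g e -> False.
Proof.
move=> me cf cg [_ [p [/(on_c cf) pf /(on_m me) pe]]] [_ [q [/(on_c cg) qg /(on_m me) qe]]].
have wp := matching_passes (ord_n j) pe (on_cycle_edge_x pf).
have [] := on_cycle_edge_y (ord_n i) pf; have [] := on_cycle_edge_y (ord_n _) qg.
case: pe qe => [-> _ _] [-> _ _]; rewrite !ltr_nat {pf qg}.
have vS : ordS i = _ :> nat := val_ordS i.
rewrite vS; have n0 : (0%N == n) = false by lia.
have i_n := ord_n i; have j_n := ord_n j.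
have [iN|iN] := eqVneq (i : nat) n.
  rewrite n0 => a b a' b'.
  (* A segment of level 2 or more would run above the level 1 vertex of the cycle. *)
  have j1 : (j <= 1)%N by rewrite leqNgt; apply/negP => /(height_lt x z); lia.
  have w1 := gray_width_lt_exp x j; have w2 := gray_width_lt_exp z j.
  rewrite !size_tuple in w1 w2.
  have [j0|j0] := eqVneq (j : nat) 0%N.
    by move: wp w1 w2 a; rewrite /height j0 /= expnS; lia.
  have {j0} j0 : (j : nat) = 1%N by lia.
  have n1 : (1%N == n.-1) = false by lia.
  by move: wp b; rewrite /height j0 /= n1; lia.
have [iN'|iN'] := eqVneq i.+1 n; last by lia.
move=> a b a' b'.
have j1 : (n.-1 <= j)%N.
  rewrite leqNgt; apply/negP => ji; have := @height_lt z x j i; lia.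
have w1 := gray_width_lt_exp x j; have w2 := gray_width_lt_exp z j.
rewrite !size_tuple in w1 w2.
have [jn|jn] := eqVneq (j : nat) n.-1.
  have ij : (i : nat) = j by lia.
  have : (2 * 2 ^ d <= j.+1 * 2 ^ d.+1)%N by rewrite -expnS leq_pmull.
  move: a'; rewrite ij /height jn eqxx orbT -jn.
  by move: (j.+1 * _)%N => M; lia.
have jN : (j : nat) = n by lia.
have n1 : (n == n.-1) = false by lia.
have n0' : (n == 0%N) = false by lia.
by move: wp b'; rewrite iN' /height jN n1 n0' /=; lia.
Qed.

Lemma CCC_fan_crossing_free_drawing : fan_crossing_free_drawing D.
Proof.
move=> e f g [fg [v [vf vg]]] [cfe cge].
have [[x [i ce]]|[z [j me]]] := edge_class e.
  have [[y [l cf]]|[y [l mf]]] := edge_class f.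
    exact: (cycle_edges_not_cross cf ce cfe).
  have [[y' [l' cg]]|[y' [l' mg]]] := edge_class g.
    exact: (cycle_edges_not_cross cg ce cge).
  (* Two matching edges with a common vertex are equal. *)
  apply: fg; apply: val_inj; move: vf vg.
  case: mf mg => _ Ef [_ Eg]; rewrite /incident Ef Eg !inE.
  case/orP => /eqP-> /orP[] /eqP E; have E1 := congr1 fst E;
    have E2 := congr1 snd E; move: E1 E2 => /= E1 E2; subst l'.
  - by rewrite E1.
  - by rewrite E1 flip_bitK finset.setUC.
  - by rewrite -E1 flip_bitK finset.setUC.
  - by have -> : y = y' by rewrite -(flip_bitK y l) E1 flip_bitK.
have [[x [i cf]]|[y [l mf]]] := edge_class f; last exact: (matching_edges_not_cross mf me cfe).
have [[y [l cg]]|[y [l mg]]] := edge_class g; last exact: (matching_edges_not_cross mg me cge).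
(* Distinct cycle edges with a common vertex are consecutive, in one of the two orders. *)
have ne : (x, i) <> (y, l).
  by case=> xy il; apply: fg; apply: val_inj; rewrite cf cg xy il.
move: vf vg; rewrite /incident cf cg !inE.
case/orP => /eqP-> /orP[] /eqP[xy il].
- by case: ne; rewrite xy il.
- by subst; exact: (consecutive_not_both_crossed me cg cf cge cfe).
- by subst; exact: (consecutive_not_both_crossed me cf cg cfe cge).
- by case: ne; rewrite xy -(ordSK i) -(ordSK l) (ord_inj (il : ordS i = ordS l :> nat)).
Qed.

End Properties.

End CCCDrawing.

Lemma exp2_gt_linear (c : nat) : exists n, (3 <= n)%N /\ (c * n.+1 < 2 ^ n.+1)%N.
Proof.
(* With d = 2 m and m >= 2 c, one gets c d <= m^2 < (2^m)^2 = 2^d. *)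
pose m := (2 * c + 2)%N; exists (2 * m).-1; split; first by rewrite /m; lia.
have -> : (2 * m).-1.+1 = (m + m)%N by rewrite /m; lia.
have h : (m < 2 ^ m)%N by rewrite ltn_expl.
apply: (@leq_ltn_trans (m * m)%N); first by rewrite /m; lia.
by rewrite expnD ltn_mul.
Qed.

Theorem theorem6 (R : realType) (k : nat) :
  exists d : nat,
    (3 <= d)%N /\
    fan_crossing_free R (CCC d) /\
    quasi_planar R (CCC d) /\
    ~ k_planar k R (CCC d) /\
    ~ k_gap_planar k R (CCC d) /\
    ~ fan_crossing R (CCC d).
Proof.
(* The maximum with 3 lets the same [d] also exclude 3-gap-planar drawings, hence fan-crossing
   ones. *)
have [n [n3 large]] := exp2_gt_linear (729 * (1 + 4 * maxn k 3)).
have not_gap l : (l <= maxn k 3)%N -> ~ k_gap_planar l R (CCC n.+1).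
  move=> lk /k_gap_planar_CCC_bound h; move: large; rewrite ltnNge => /negP; apply.
  apply: leq_trans h _; rewrite -!mulnA [(n.+1 * _)%N]mulnC.
  by rewrite leq_mul2l leq_mul2r leq_add2l leq_mul2l lk !orbT.
have [D HD] := CCC_drawing R n3.
exists n.+1; split; first exact: ltnW.
split; first by exists D; split;
  [exact: CCC_simple_drawing | exact: CCC_fan_crossing_free_drawing].
split; first by exists D; split;
  [exact: CCC_simple_drawing | exact: CCC_quasi_planar_drawing].
split; first by move/k_planar_gap; apply: not_gap; rewrite leq_maxl.
split; first by apply: not_gap; rewrite leq_maxl.
by move/fan_crossing_3_planar/k_planar_gap; apply: not_gap; rewrite leq_maxr.
Qed.
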